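(* Let $n\ge 1$ and let $(t_1,t_2,\cdots,t_n),(t_1',t_2',\cdots,t_n')\in\Bbbk^n$. Then the DG algebras $\mathcal{A}(t_1,t_2,\cdots,t_n)$ and $\mathcal{A}(t_1',t_2',\cdots,t_n')$ are isomorphic if and only if there is a matrix $M\in\mathrm{GL}_n(\Bbbk)$ such that $$(t_1',t_2',\cdots,t_n')=(t_1,t_2,\cdots,t_n)M.$$
   Context: $\Bbbk$ is an algebraically closed field of characteristic $0$. A cochain DG algebra is a graded $\Bbbk$-algebra $\mathcal{A}$ with a $\Bbbk$-linear differential $\partial_{\mathcal{A}}$ of degree $1$, $\partial_{\mathcal{A}}^2=0$, satisfying $\partial_{\mathcal{A}}(ab)=(\partial_{\mathcal{A}}a)b+(-1)^{|a|}a(\partial_{\mathcal{A}}b)$ for all homogeneous $a,b$. For $(t_1,\dots,t_n)\in\Bbbk^n$, $\mathcal{A}(t_1,\dots,t_n)$ denotes the cochain DG algebra whose underlying graded algebra is the ordinary commutative polynomial algebra $\Bbbk[x_1,\dots,x_n]$ with $|x_i|=1$ and whose differential is determined, via the Leibniz rule, by $\partial_{\mathcal{A}}(x_i)=\sum_{j=1}^{n}t_jx_ix_j$ for all $i$. A morphism of DG algebras is a chain map (of degree $0$) respecting multiplication and unit; an isomorphism of DG algebras is a bijective such morphism. *)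

(* Defs.v *)
From HB Require Import structures.
From mathcomp Require Import all_boot all_order all_algebra.
From mathcomp Require Export mpoly.

Set Implicit Arguments.
Unset Strict Implicit.
Unset Printing Implicit Defensive.

Import GRing.Theory.
Local Open Scope ring_scope.

(* [deg i] is the degree-[i] component; the last two clauses say that [A] is
   the internal direct sum of these components. *)
Record is_grading (k : fieldType) (A : algType k) (deg : int -> {pred A}) :
    Prop := IsGrading {
  grading_submod : forall i, submod_closed (deg i);
  grading_one : 1 \in deg 0;
  grading_mul : forall i j a b,
    a \in deg i -> b \in deg j -> a * b \in deg (i + j);
  grading_span : forall a : A, exists (s : seq int) (f : int -> A),
    (forall i, f i \in deg i) /\ a = \sum_(i <- s) f i;
  grading_direct : forall (s : seq int) (f : int -> A),
    uniq s -> (forall i, f i \in deg i) -> \sum_(i <- s) f i = 0 ->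
    forall i, i \in s -> f i = 0
}.

Record is_differential (k : fieldType) (A : algType k) (deg : int -> {pred A})
    (d : A -> A) : Prop := IsDifferential {
  diff_deg1 : forall i a, a \in deg i -> d a \in deg (i + 1);
  diff_square : forall a, d (d a) = 0;
  diff_leibniz : forall i j a b, a \in deg i -> b \in deg j ->
    d (a * b) = d a * b + (-1) ^+ `|i|%N * a * d b
}.

Record dgAlgebra (k : fieldType) := DGAlgebra {
  dg_alg :> algType k;
  dg_deg : int -> {pred dg_alg};
  dg_diff : {linear dg_alg -> dg_alg};
  dg_gradingP : is_grading dg_deg;
  dg_differentialP : is_differential dg_deg dg_diff
}.

Arguments dg_deg {k} A i : rename.
Arguments dg_diff {k} A : rename.

Definition dg_morphism (k : fieldType) (A B : dgAlgebra k)
    (f : {lrmorphism A -> B}) : Prop :=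
  (forall i a, a \in dg_deg A i -> f a \in dg_deg B i)
  /\ (forall a, f (dg_diff A a) = dg_diff B (f a)).

Definition dg_isomorphic (k : fieldType) (A B : dgAlgebra k) : Prop :=
  exists f : {lrmorphism A -> B}, dg_morphism f /\ bijective f.

Section PolynomialDGAlgebra.

Variables (k : fieldType) (n : nat).
Implicit Types (p q : {mpoly k[n]}) (t : 'rV[k]_n).

Definition mpoly_deg (i : int) : {pred {mpoly k[n]}} :=
  if i is Posz d then [pred p | p \is d.-homog] else pred1 0.

Definition odd_part p : {mpoly k[n]} :=
  \sum_(m <- msupp p | odd (mdeg m)) p@_m *: 'X_[m].

(* The variables commute strictly although they have odd degree, so Leibniz'
   rule and d x_i = x_i (t_1 x_1 + ... + t_n x_n) force, on a monomial u,
   d u = u (t_1 x_1 + ... + t_n x_n) for deg u odd and d u = 0 for deg u even.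
   Lemmas [mpoly_diffX], [mpoly_differential] and [mpoly_diff_unique] below
   show that this is the unique differential with these values on the x_i. *)
Definition mpoly_diff t p : {mpoly k[n]} :=
  odd_part p * \sum_(j < n) t 0 j *: 'X_j.

Lemma mcoeff_odd_part p m :
  (odd_part p)@_m = if odd (mdeg m) then p@_m else 0.
Proof.
rewrite /odd_part raddf_sum /=.
under eq_bigr do rewrite mcoeffZ mcoeffX.
have [pm|pm] := boolP (m \in msupp p); last first.
  rewrite (memN_msupp_eq0 pm) if_same big1_seq // => m' /andP[_ m'p].
  by case: eqP => [e|]; rewrite ?mulr0 //; rewrite -e m'p in pm.
rewrite big_mkcond (bigD1_seq m) ?msupp_uniq //= eqxx mulr1 big1 ?addr0 //.
by move=> m' /negbTE ->; rewrite mulr0 if_same.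
Qed.

Lemma odd_part_homog d p : p \is d.-homog ->
  odd_part p = if odd d then p else 0.
Proof.
move=> hp; apply/mpolyP => m; rewrite mcoeff_odd_part.
have [e|e] := eqVneq (mdeg m) d; first by rewrite e; case: ifP; rewrite ?mcoeff0.
by rewrite (fun_if (fun q : {mpoly k[n]} => q@_m)) mcoeff0
  (dhomog_nemf_coeff hp e) !if_same.
Qed.

Lemma mpoly_diff_linear t : linear (mpoly_diff t).
Proof.
move=> c p q; rewrite /mpoly_diff scalerAl -mulrDl; congr (_ * _).
apply/mpolyP => m; rewrite mcoeffD mcoeffZ !mcoeff_odd_part mcoeffD mcoeffZ.
by case: ifP => // _; rewrite mulr0 addr0.
Qed.

HB.instance Definition _ t := GRing.isLinear.Build k {mpoly k[n]} {mpoly k[n]}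
  _ (mpoly_diff t) (mpoly_diff_linear t).

Lemma mpoly_diff_homog t d p : p \is d.-homog ->
  mpoly_diff t p = if odd d then p * \sum_(j < n) t 0 j *: 'X_j else 0.
Proof.
by move=> hp; rewrite /mpoly_diff (odd_part_homog hp); case: ifP; rewrite ?mul0r.
Qed.

Lemma homogX (i : 'I_n) : ('X_i : {mpoly k[n]}) \is 1.-homog.
Proof. by rewrite dhomogX; apply/eqP/mdeg1. Qed.

Lemma mpoly_diffX t (i : 'I_n) :
  mpoly_diff t 'X_i = \sum_(j < n) t 0 j *: ('X_i * 'X_j).
Proof.
rewrite (mpoly_diff_homog t (homogX i)) /= mulr_sumr.
by apply: eq_bigr => j _; rewrite scalerAr.
Qed.

Lemma mpoly_deg0 i : 0 \in mpoly_deg i.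
Proof. by case: i => d; rewrite inE ?eqxx ?rpred0. Qed.

Lemma mpoly_deg1 : 1 \in mpoly_deg 0.
Proof. exact: dhomog1. Qed.

Lemma mpoly_deg_neg d p : p \in mpoly_deg (Negz d) -> p = 0.
Proof. by rewrite inE => /eqP. Qed.

Lemma mpoly_grading : is_grading mpoly_deg.
Proof.
split.
- case=> d /=; first exact: dhomog_submod_closed.
  split=> [|c p q]; first by rewrite inE.
  rewrite !inE; move=> /eqP-> /eqP->.
  by rewrite scaler0 addr0.
- exact: mpoly_deg1.
- case=> [d|d] [e|e] p q; first exact: dhomogM.
  + by move=> _ /mpoly_deg_neg->; rewrite mulr0 mpoly_deg0.
  + by move=> /mpoly_deg_neg->; rewrite mul0r mpoly_deg0.
  + by move=> /mpoly_deg_neg->; rewrite mul0r mpoly_deg0.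
- move=> p; exists (map Posz (iota 0 (msize p))).
  exists (fun i => if i is Posz d then pihomog mdeg d p else 0); split.
    by case=> d; rewrite inE ?eqxx // pihomogP.
  rewrite big_map -{1}[msize p]subn0 -/(index_iota 0 (msize p)) big_mkord.
  exact: pihomog_partitionE.
- move=> s f us hf s0 [d|d] ds; last by exact: mpoly_deg_neg (hf _).
  have := congr1 (pihomog mdeg d) s0; rewrite raddf0 raddf_sum /=.
  rewrite (bigD1_seq (Posz d)) //= (pihomog_dE (hf (Posz d))) big1 ?addr0 //.
  case=> [e|e] ne; last by rewrite (mpoly_deg_neg (hf (Negz e))) raddf0.
  by apply: (pihomog_ne0 _ (hf (Posz e))).
Qed.

Lemma mpoly_differential t : is_differential mpoly_deg (mpoly_diff t).
Proof.
have hT : (\sum_(j < n) t 0 j *: 'X_j : {mpoly k[n]}) \is 1.-homog.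
  by apply: rpred_sum => j _; apply: rpredZ; apply: homogX.
have h1 i p : p \in mpoly_deg i -> mpoly_diff t p \in mpoly_deg (i + 1).
  case: i => [d|d] hp; last by rewrite (mpoly_deg_neg hp) raddf0 mpoly_deg0.
  rewrite inE /= (mpoly_diff_homog t hp).
  by case: ifP => _; [exact: dhomogM|rewrite rpred0].
split=> [//|p|].
  rewrite [p](pihomog_partitionE (k := msize p) (mf := mdeg)) // !raddf_sum /=.
  apply: big1 => d _; have hp := pihomogP mdeg d p.
  rewrite (mpoly_diff_homog t hp); case: ifP => [od|_]; last by rewrite raddf0.
  by rewrite (mpoly_diff_homog t (dhomogM hp hT)) addn1 /= od.
case=> [d|d] [e|e] p q; last 3 first.
- by move=> _ /mpoly_deg_neg->; rewrite mulr0 !raddf0 !mulr0 addr0.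
- by move=> /mpoly_deg_neg-> _; rewrite mul0r !raddf0 mulr0 !mul0r addr0.
- by move=> /mpoly_deg_neg-> _; rewrite mul0r !raddf0 mulr0 !mul0r addr0.
move=> hp hq; rewrite (mpoly_diff_homog t (dhomogM hp hq)).
rewrite (mpoly_diff_homog t hp) (mpoly_diff_homog t hq) oddD /= -signr_odd.
case: (odd d); case: (odd e); rewrite /= ?expr0 ?expr1 ?mul1r ?mulN1r ?mulr0
  ?mul0r ?addr0 ?add0r ?mulNr ?mulrA //.
- by rewrite [p * _ * q]mulrAC subrr.
- by rewrite [RHS]mulrAC.
Qed.

Lemma mpoly_diff_unique t (d : {linear {mpoly k[n]} -> {mpoly k[n]}}) :
    is_differential mpoly_deg d ->
    (forall i : 'I_n, d 'X_i = \sum_(j < n) t 0 j *: ('X_i * 'X_j)) ->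
  d =1 mpoly_diff t.
Proof.
move=> [_ _ dL] dX p; have [_ _ tL] := mpoly_differential t.
have d1 (D : {mpoly k[n]} -> {mpoly k[n]}) :
    (forall i j a b, a \in mpoly_deg i -> b \in mpoly_deg j ->
      D (a * b) = D a * b + (-1) ^+ `|i|%N * a * D b) -> D 1 = 0.
  move=> DL; have /= := DL 0 0 1 1 mpoly_deg1 mpoly_deg1.
  rewrite !mulr1 mul1r => e.
  by apply: (addrI (D 1)); rewrite addr0 -e.
rewrite [p]mpolyE !raddf_sum /=; apply: eq_bigr => m _; rewrite !linearZ /=.
congr (_ *: _); elim: {m}(mdeg m) {-2}m (erefl (mdeg m)) => [|N IH] m mN.
  by move/eqP: mN; rewrite mdeg_eq0 => /eqP->; rewrite mpolyX0 (d1 _ dL) (d1 _ tL).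
have [i mi] : exists i, m i != 0%N.
  apply/existsP; apply: contra_eqT mN; rewrite negb_exists => /forallP m0.
  rewrite mdegE big1 // => i _; by apply/eqP; rewrite -[_ == _]negbK.
have [m' em] : exists m', m = (U_(i) + m')%MM.
  by exists (m - U_(i))%MM; rewrite addmC submK // lep1mP.
move: mN; rewrite {}em mdegD mdeg1 add1n => -[m'N].
have hX : ('X_[m'] : {mpoly k[n]}) \in mpoly_deg N.
  by rewrite inE /= dhomogX; apply/eqP.
rewrite mpolyXD (dL 1 N _ _ (homogX i) hX) (tL 1 N _ _ (homogX i) hX).
by rewrite dX mpoly_diffX IH.
Qed.

Definition polyDG t : dgAlgebra k :=
  @DGAlgebra k {mpoly k[n]} mpoly_deg (mpoly_diff t) mpoly_grading
    (mpoly_differential t).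

End PolynomialDGAlgebra.

(* Main.v *)
Require Import Defs.
From HB Require Import structures.
From mathcomp Require Import all_boot all_order all_algebra.
Import GRing.Theory.
Local Open Scope ring_scope.

(** Write [T] for the linear form [t_1 x_1 + ... + t_n x_n], so that
    [d x_i = x_i T]. A morphism [f] of DG algebras maps each [x_i] to a linear
    form, and [f (x_i) f (T) = f (d x_i) = d (f x_i) = f (x_i) T'] in an integral
    domain, hence [f T = T']: [t'] is the image of [t] under the matrix of [f] in
    degree 1, which is invertible since [f] is injective. Conversely, a linear
    change of variables mapping [T] to [T'] preserves the degree, hence commutes
    with the differentials, which are multiplication by [T] or [T'] in odd degree
    and zero in even degree. *)

Section LinearForms.

Variables (k : fieldType) (n : nat).
Implicit Types (p : {mpoly k[n]}) (v : 'rV[k]_n) (M N : 'M[k]_n).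

Definition linform v : {mpoly k[n]} := \sum_(j < n) v 0 j *: 'X_j.

Lemma mcoeff_linform v i : (linform v)@_U_(i) = v 0 i.
Proof.
rewrite /linform raddf_sum /= (bigD1 i) //= mcoeffZ mcoeffXU eqxx mulr1.
rewrite big1 ?addr0 // => j /negbTE ji.
by rewrite mcoeffZ mcoeffXU ji mulr0.
Qed.

Lemma linform_inj : injective linform.
Proof. by move=> u v e; apply/rowP => i; rewrite -!mcoeff_linform e. Qed.

Lemma linform0 : linform 0 = 0.
Proof. by apply: big1 => j _; rewrite mxE scale0r. Qed.

Lemma linform_delta i : linform (delta_mx 0 i) = 'X_i.
Proof.
rewrite /linform (bigD1 i) //= mxE !eqxx scale1r big1 ?addr0 // => j /negbTE ji.
by rewrite mxE ji andbF scale0r.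
Qed.

Lemma linform_homog v : linform v \is 1.-homog.
Proof. by apply: rpred_sum => j _; apply: rpredZ; apply: homogX. Qed.

Lemma homog1_linform p : p \is 1.-homog -> p = linform (\row_j p@_U_(j)).
Proof.
move=> hp; apply/mpolyP => m.
have [m1|m1] := eqVneq (mdeg m) 1%N; last first.
  by rewrite (dhomog_nemf_coeff hp m1) (dhomog_nemf_coeff (linform_homog _) m1).
have /mdeg1P[i  /eqP->] : mdeg m == 1%N by rewrite m1.
by rewrite mcoeff_linform mxE.
Qed.

(** Only linearity is asked of [f], so this serves both the substitution by [M] and the degree 1
    part of an arbitrary DG morphism. *)
Lemma map_linform M (f : {linear {mpoly k[n]} -> {mpoly k[n]}}) :
  (forall i, f 'X_i = linform (row i M)) ->
  forall v, f (linform v) = linform (v *m M).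
Proof.
move=> fX v; rewrite raddf_sum /=.
under eq_bigr do rewrite linearZ /= fX scaler_sumr.
rewrite exchange_big; apply: eq_bigr => j _ /=.
by rewrite mxE scaler_suml; apply: eq_bigr => i _; rewrite mxE scalerA.
Qed.

(** Images of the variables are the rows of [M], so that row vectors of coefficients are multiplied
    by [M] on the right. *)
Definition linsubst M : {mpoly k[n]} -> {mpoly k[n]} :=
  comp_mpoly [tuple linform (row i M) | i < n].

HB.instance Definition _ M := GRing.LRMorphism.on (linsubst M).

Lemma linsubstX M i : linsubst M 'X_i = linform (row i M).
Proof. by rewrite /linsubst comp_mpolyXU -tnth_nth tnth_mktuple. Qed.

Lemma linsubst_linform M v : linsubst M (linform v) = linform (v *m M).
Proof. exact: map_linform (linsubstX M) v. Qed.

Lemma linsubst_homog M d p : p \is d.-homog -> linsubst M p \is d.-homog.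
Proof.
move=> hp; rewrite /linsubst comp_mpolyE big_seq; apply: rpred_sum => m mp.
rewrite rpredZ // -(dhomog_mf hp mp) /= mdegE.
(* The product of powers of linear forms and the sum of their exponents are built up in parallel,
   one variable at a time. *)
elim/big_rec2: _ => [|i d' q _ hq]; first exact: dhomog1.
rewrite dhomogM // tnth_mktuple.
by have := dhomogMn (m i) (linform_homog (row i M)); rewrite mul1n.
Qed.

Lemma linsubst_deg M i p : p \in mpoly_deg i -> linsubst M p \in mpoly_deg i.
Proof.
case: i => d; first exact: linsubst_homog.
by move/mpoly_deg_neg->; rewrite raddf0 mpoly_deg0.
Qed.

(** Both sides are algebra morphisms, so the variables decide. Since coefficients are rows, the
    substitution applied first is the left factor. *)
Lemma linsubst_comp M N p : linsubst N (linsubst M p) = linsubst (M *m N) p.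
Proof.
elim/mpolyind: p => [|c m p _ _ IH]; first by rewrite !raddf0.
rewrite !raddfD /= IH !linearZ /=; congr (_ *: _ + _).
rewrite mpolyXE_id !rmorph_prod /=; apply: eq_bigr => i _.
by rewrite !rmorphXn /= !linsubstX linsubst_linform row_mul.
Qed.

Lemma linsubst1 p : linsubst 1%:M p = p.
Proof.
rewrite -[RHS]comp_mpoly_id /linsubst; congr comp_mpoly.
by apply: eq_mktuple => i; rewrite row1 linform_delta.
Qed.

Lemma linsubst_bij M : M \in unitmx -> bijective (linsubst M).
Proof.
move=> uM; exists (linsubst (invmx M)) => p.
  by rewrite linsubst_comp mulmxV ?linsubst1.
by rewrite linsubst_comp mulVmx ?linsubst1.
Qed.

(** By additivity [p] may be taken homogeneous; its image has the same degree, so the parity test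
    agrees on both sides. *)
Lemma linsubst_diff M t p :
  linsubst M (mpoly_diff t p) = mpoly_diff (t *m M) (linsubst M p).
Proof.
rewrite [p](pihomog_partitionE (k := msize p) (mf := mdeg)) //.
rewrite (raddf_sum (mpoly_diff t)) !(raddf_sum (linsubst M)) raddf_sum /=.
apply: eq_bigr => d _; have hp := pihomogP mdeg d p.
rewrite (mpoly_diff_homog t hp) (mpoly_diff_homog _ (linsubst_homog M _ _ hp)).
by case: ifP => _; rewrite ?raddf0 // rmorphM /= linsubst_linform.
Qed.

Lemma linsubst_dg_isomorphic M t :
  M \in unitmx -> dg_isomorphic (polyDG t) (polyDG (t *m M)).
Proof.
move=> uM; exists (linsubst M : {lrmorphism {mpoly k[n]} -> {mpoly k[n]}}).
split; last exact: linsubst_bij.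
split=> [i p|p]; [exact: linsubst_deg|exact: linsubst_diff].
Qed.

Lemma dg_isomorphic_unitmx t t' : dg_isomorphic (polyDG t) (polyDG t') ->
  exists M : 'M[k]_n, M \in unitmx /\ t' = t *m M.
Proof.
case=> f0 [[]]; pose f : {lrmorphism {mpoly k[n]} -> {mpoly k[n]}} := f0.
rewrite -/f => /= fdeg fd /bij_inj finj.
pose M := \matrix_(i, j) (f 'X_i)@_U_(j).
have fX i : f 'X_i = linform (row i M).
  rewrite {1}(homog1_linform _ (fdeg 1 _ (homogX _ i))); congr linform.
  by apply/rowP => j; rewrite !mxE.
have fT := map_linform M f fX.
exists M; split.
  (* A row [v] with [v *m M = 0] gives a linear form killed by the injective [f]. *)
  rewrite -row_free_unit -kermx_eq0; apply/rowV0P => v /sub_kermxP vM0.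
  by apply/linform_inj/finj; rewrite linform0 raddf0 fT vM0 linform0.
(* Extensionality serves only to obtain a variable ['X_i]; the goal then returns to whole rows. *)
apply/rowP => i; congr (fun_of_matrix _ 0 i).
apply: linform_inj; rewrite -fT.
have fXi0 : f 'X_i != 0 by rewrite -(raddf0 f) (inj_eq finj) -msupp_eq0 msuppX.
(* After cancellation of [f 'X_i], what remains is compatibility of [f] with the differentials at
   ['X_i]. *)
apply: (mulfI fXi0); rewrite -rmorphM /=.
have := fd 'X_i; rewrite (mpoly_diff_homog t (homogX _ i)) /=.
by rewrite (mpoly_diff_homog t' (fdeg 1 _ (homogX _ i))) => ->.
Qed.

End LinearForms.

Theorem theoremB (k : closedFieldType) (char0 : [pchar k] =i pred0)
    (n : nat) (n_ge1 : (1 <= n)%N) (t t' : 'rV[k]_n) :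
  dg_isomorphic (polyDG t) (polyDG t')
  <-> exists M : 'M[k]_n, M \in unitmx /\ t' = t *m M.
Proof.
split; first exact: dg_isomorphic_unitmx.
by case=> M [uM ->]; apply: linsubst_dg_isomorphic.
Qed.
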